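(* Let $L$ be a finite atomistic lattice without any $D$-cycle of the form $a\mathbin{D}b\mathbin{D}a$. Then $L$ belongs to $\mathbf{SUB}$ if and only if $L$ belongs to $\mathbf{SUB}_2$. In particular, $L$ has no $D$-cycle.
   Context: For a poset $(P,\trianglelefteq)$, a subset $X\subseteq P$ is order-convex if $x\trianglelefteq z\trianglelefteq y$ and $\{x,y\}\subseteq X$ imply $z\in X$, for all $x,y,z\in P$. $\mathbf{Co}(P)$ is the lattice of all order-convex subsets of $P$ under inclusion. The length of $P$ is the supremum of $|C|-1$ over finite subchains $C$ of $P$. $\mathbf{SUB}$ (resp., $\mathbf{SUB}_2$) is the class of all lattices that can be embedded into $\mathbf{Co}(P)$ for some poset $P$ (resp., some poset $P$ of length at most $2$). $\mathrm{J}(L)$ is the set of join-irreducible elements of $L$ (a least element is not considered join-irreducible). The join-dependency relation $D$ on $\mathrm{J}(L)$ is defined by: $p\mathbin{D}q$ if $p\neq q$ and there is $x\in L$ such that $p\le q\vee x$ and $p\nleq y\vee x$ for all $y<q$. A $D$-cycle is a finite sequence $a_0\mathbin{D}a_1\mathbin{D}\cdots\mathbin{D}a_k=a_0$ of elements of $\mathrm{J}(L)$ with $k\ge 1$. A lattice is atomistic if every element is a join of atoms.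
   Formalization: The closing claim ''L has no D-cycle'' is stated under the assumption that L belongs to SUB; without that assumption it is false, since some finite atomistic lattices with no cycle a D b D a have a D-cycle of length 3. *)

(* Defs.v *)
From HB Require Import structures.
From mathcomp Require Import all_boot all_order finmap.
From mathcomp Require Import boolp classical_sets.

Set Implicit Arguments.
Unset Strict Implicit.
Unset Printing Implicit Defensive.

Import Order.Theory.
Local Open Scope order_scope.

Section OrderConvex.
Context {d : Order.disp_t} {P : porderType d}.
Implicit Types (X Y : set P) (A : set (set P)).

Definition order_convex X : Prop :=
  forall x y z : P, X x -> X y -> x <= z -> z <= y -> X z.

Lemma order_convexI X Y :
  order_convex X -> order_convex Y -> order_convex (X `&` Y)%classic.
Proof.
move=> cX cY x y z [Xx Yx] [Xy Yy] xz zy.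
by split; [apply: (cX x y) | apply: (cY x y)].
Qed.

Definition convex_hull X : set P :=
  (\bigcap_(Z in [set Z | order_convex Z /\ (X `<=` Z)%classic]) Z)%classic.

Lemma order_convex_hull X : order_convex (convex_hull X).
Proof.
move=> x y z hx hy xz zy Z [cZ XZ].
by apply: (cZ x y) => //; [apply: hx | apply: hy].
Qed.

End OrderConvex.

Fact convex_display : Order.disp_t. Proof. exact: Order.Disp tt tt. Qed.

(* The lattice Co(P). Its order is inherited from [set P], i.e. inclusion. *)
Section Co.
Context {d : Order.disp_t} (P : porderType d).

Record Co := MkCo {
  co_set :> set P;
  co_convex : `[< order_convex co_set >]
}.

HB.instance Definition _ := [isSub for co_set].
HB.instance Definition _ := [Choice of Co by <:].
HB.instance Definition _ :=
  [SubChoice_isSubPOrder of Co by <: with convex_display].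

Lemma co_leE (X Y : Co) : (X <= Y) = `[< (co_set X `<=` co_set Y)%classic >].
Proof. by []. Qed.

Lemma co_convexP (X : Co) : order_convex (co_set X).
Proof. exact/asboolP/co_convex. Qed.
Arguments co_convexP : clear implicits.

Definition co_meet (X Y : Co) : Co :=
  MkCo (asboolT (order_convexI (co_convexP X) (co_convexP Y))).

Definition co_join (X Y : Co) : Co :=
  MkCo (asboolT (@order_convex_hull d P (X `|` Y)%classic)).

Lemma co_meetP (X Y Z : Co) : (X <= co_meet Y Z) = (X <= Y) && (X <= Z).
Proof.
rewrite !co_leE; apply/asboolP/andP => [XYZ|[/asboolP XY /asboolP XZ]].
  by split; apply/asboolP => x /XYZ [].
by move=> x Xx; split; [apply: XY | apply: XZ].
Qed.

Lemma co_joinP (X Y Z : Co) : (co_join X Y <= Z) = (X <= Z) && (Y <= Z).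
Proof.
rewrite !co_leE; apply/asboolP/andP => [XYZ|[/asboolP XZ /asboolP YZ]].
  by split; apply/asboolP => x Xx; apply: XYZ => W [_]; apply; [left | right].
move=> x; apply; split; first exact: co_convexP.
by move=> y [/XZ|/YZ].
Qed.

HB.instance Definition _ :=
  Order.POrder_MeetJoin_isLattice.Build convex_display Co co_meetP co_joinP.

End Co.

(* The length of [P], i.e. the supremum of the |C| - 1 over the finite
   subchains C of P, is at most [n]. *)
Definition length_at_most {d : Order.disp_t} (P : porderType d) (n : nat) :
    Prop :=
  forall C : {fset P},
    {in C &, forall x y : P, x >=< y} -> (#|` C|.-1 <= n)%N.

Definition embeds {d d' : Order.disp_t} (L : latticeType d)
    (M : latticeType d') : Prop :=
  exists f : {lmorphism L -> M}, injective f.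

Definition SUB {d : Order.disp_t} (L : latticeType d) : Prop :=
  exists (d' : Order.disp_t) (P : porderType d'), embeds L (Co P).

Definition SUB2 {d : Order.disp_t} (L : latticeType d) : Prop :=
  exists (d' : Order.disp_t) (P : porderType d'),
    length_at_most P 2 /\ embeds L (Co P).

Section FiniteLattice.
Context {d : Order.disp_t} {L : finTBLatticeType d}.
Implicit Types p q a x y : L.

Definition join_irreducible p : bool :=
  (p != \bot) &&
  [forall x, forall y, (p == x `|` y) ==> (p == x) || (p == y)].

Definition join_dep p q : bool :=
  [&& join_irreducible p, join_irreducible q, p != q &
    [exists x, (p <= q `|` x) &&
      [forall y, (y < q) ==> ~~ (p <= y `|` x)]]].

(* [:: a_0; ...; a_(k-1)] stands for a_0 D ... D a_(k-1) D a_k = a_0. *)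
Definition D_cycle (s : seq L) : Prop := s != [::] /\ cycle join_dep s.

Definition atom a : bool := (\bot < a) && [forall x, (x < a) ==> (x == \bot)].

End FiniteLattice.

Definition atomistic {d : Order.disp_t} (L : finTBLatticeType d) : Prop :=
  forall x : L, exists2 A : {set L},
    {in A, forall a, atom a} & x = \join_(a in A) a.

(* Main.v *)
Require Import Defs.
From HB Require Import structures.
From mathcomp Require Import all_boot all_order finmap.
From mathcomp Require Import boolp classical_sets.

(** Let f embed L into Co(P). A point p is marked by an atom a when p lies in
    f(a) but not in f(0); then p lies in f(x) exactly when a <= x, so an
    inequality between elements of L can be read off from the position of a
    single point.

    Suppose a D b, say a <= b \/ w. A point p marked by a lies strictly between
    a point q of f(b) and a point of f(w); say q is below p. If b <= u \/ v
    with b below neither u nor v, then q itself lies between points of f(u) and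
    f(v), and one of these, say r in f(u), is on the side of q opposite to p:
    r <= q <= p. Hence b <= a \/ u, that is, b D a, against the absence of
    2-cycles. So every target b of D is join-prime ([join_dep_prime]). A
    join-prime element has no D-successor, so D has no path with two edges and
    in particular no cycle.

    This is also what makes length 2 enough. Give every point p of P its own
    component, with p in the middle, and, below and above p, one copy of every
    element of L; components are unrelated and each has three levels. Send x
    to the set of the following elements, for marked p: the middle point p if p
    is in f(x), and the copies at p of the join-prime b <= x such that f(b) has
    a point on that side of p. Joins are preserved at the outer levels because
    the labels are join-prime, and at a middle point p of f(x \/ y) because p
    lies between a point of f(x) and a point of f(y), which can be pushed
    further away from p into f(b) and f(c) for atoms b <= x and c <= y
    ([reaches_all]); the atom marking p then satisfies a D b and a D c, so b
    and c are join-prime and their copies surround p. *)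

Set Implicit Arguments.
Unset Strict Implicit.
Unset Printing Implicit Defensive.

Import Order.Theory.
Local Open Scope order_scope.

(** * Membership in joins of order-convex sets *)
Section CoMembership.
Context {d : Order.disp_t} {P : porderType d}.
Implicit Types (X Y : Co P) (z : P).

Lemma co_subset X Y z : X <= Y -> co_set X z -> co_set Y z.
Proof. by rewrite co_leE => /asboolP XY /XY. Qed.

(** The points between two points of the union already form a convex set. *)
Lemma in_co_join X Y z :
  co_set (X `|` Y) z <->
  exists l h,
    [/\ co_set X l \/ co_set Y l, co_set X h \/ co_set Y h & l <= z <= h].
Proof.
split.
  pose hull (t : P) := exists l h,
    [/\ co_set X l \/ co_set Y l, co_set X h \/ co_set Y h & l <= t <= h].
  suff hullP : order_convex hull /\ (co_set X `|` co_set Y `<=` hull)%classic.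
    by move/(_ hull hullP).
  split=> [x y t|x XYx]; last by exists x, x; rewrite lexx.
  move=> [l [_ [XYl _ /andP[lx _]]]] [_ [h [_ XYh /andP[_ yh]]]] xt ty.
  by exists l, h; rewrite (le_trans lx xt) (le_trans ty yh).
move=> [l [h [XYl XYh /andP[lz zh]]]].
have XYsub t : co_set X t \/ co_set Y t -> co_set (X `|` Y) t.
  by case; apply: co_subset; rewrite (leUl, leUr).
exact: (co_convexP (XYsub _ XYl) (XYsub _ XYh)).
Qed.

End CoMembership.

(** * A poset of length at most 2 *)
Section Fan.
Context {T U : choiceType}.

(** The element (p, None) is the middle of the component p; (p, Some (up, u)) is
    the copy of u above p if [up] holds, and below p otherwise. *)
Definition fan : Type := (T * option (bool * U))%type.
HB.instance Definition _ := Choice.on fan.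
Implicit Types s t : fan.

Definition height t : nat :=
  match t.2 with
  | Some (false, _) => 0
  | None => 1
  | Some (true, _) => 2
  end.

Definition fan_lt s t : bool := (s.1 == t.1) && (height s < height t)%N.

Lemma fan_lt_irr : irreflexive fan_lt.
Proof. by move=> t; rewrite /fan_lt ltnn andbF. Qed.

Lemma fan_lt_trans : transitive fan_lt.
Proof.
move=> t s r /andP[/eqP st hst] /andP[/eqP tr htr].
by rewrite /fan_lt st tr eqxx (ltn_trans hst htr).
Qed.

Fact fan_display : Order.disp_t. Proof. exact: Order.Disp tt tt. Qed.

HB.instance Definition _ :=
  Order.Lt_isPOrder.Build fan_display fan fan_lt_irr fan_lt_trans.

Lemma fan_leE s t : (s <= t) = (s == t) || fan_lt s t.
Proof. by rewrite le_eqVlt. Qed.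

(** Distinct comparable elements have distinct heights, and there are three. *)
Lemma length_fan : length_at_most fan 2.
Proof.
move=> C chainC; suff: (size C <= 3)%N by case: (size C) => [|n].
have h_inj : {in C &, injective height}.
  move=> s t Cs Ct hst; have := chainC s t Cs Ct.
  rewrite /Order.comparable !fan_leE /fan_lt hst ltnn !andbF !orbF.
  by case/orP=> /eqP.
rewrite -(size_map height); apply: (@uniq_leq_size _ _ (iota 0 3)).
  by rewrite map_inj_in_uniq ?fset_uniq.
by move=> _ /mapP[[x [[[] u]|]] _ ->].
Qed.

End Fan.
Arguments fan : clear implicits.

(** * Atoms of a finite lattice *)
Section AtomisticLattice.
Context {d : Order.disp_t} {L : finTBLatticeType d}.
Implicit Types a b x y : L.

Definition join_prime b : Prop := forall x y, b <= x `|` y -> b <= x \/ b <= y.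

Lemma atom_gt0 a : atom a -> \bot < a.
Proof. by case/andP. Qed.

Lemma atom_below a x : atom a -> x <= a -> x = \bot \/ x = a.
Proof.
case/andP=> _ /forallP/(_ x)/implyP min_a; rewrite le_eqVlt.
by case/orP=> [/eqP->|/min_a/eqP]; [right | left].
Qed.

Lemma atom_ji a : atom a -> join_irreducible a.
Proof.
move=> atom_a; rewrite /join_irreducible -lt0x (atom_gt0 atom_a) /=.
apply/forallP=> x; apply/forallP=> y; apply/implyP=> /eqP aE.
have [x0|<-] : x = \bot \/ x = a; last by rewrite eqxx.
  by apply: atom_below; rewrite // aE leUl.
by rewrite {2}aE x0 join0x eqxx orbT.
Qed.

Hypothesis atomistic_L : atomistic L.

Lemma ji_atom a : join_irreducible a -> atom a.
Proof.
case/andP=> a_neq0 /forallP irr_a; have [A atomA aE] := atomistic_L a.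
suff [b atom_b ->] : exists2 b, atom b & a = b by [].
move: aE; elim/big_ind: _ => [a0|x y IHx IHy aE|b /atomA atom_b ->].
- by rewrite a0 eqxx in a_neq0.
- move/(_ x)/forallP/(_ y): irr_a; rewrite {1}aE eqxx /=.
  by case/orP=> /eqP; [apply: IHx | apply: IHy].
- by exists b.
Qed.

Lemma atomistic_le x y : (forall a, atom a -> a <= x -> a <= y) -> x <= y.
Proof.
move=> sub_xy; have [A atomA xE] := atomistic_L x.
rewrite [x in x <= _]xE; apply/joinsP => a Aa.
by apply: sub_xy (atomA a Aa) _; rewrite xE; apply: joins_sup.
Qed.

End AtomisticLattice.

(** * Join-dependency *)
Section JoinDependency.
Context {d : Order.disp_t} {L : finTBLatticeType d}.
Implicit Types a b c x y : L.

Lemma atom_join_dep a b x :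
  atom a -> atom b -> a != b -> a <= b `|` x -> ~~ (a <= x) -> join_dep a b.
Proof.
move=> atom_a atom_b ab abx ax; rewrite /join_dep !atom_ji // ab /=.
apply/existsP; exists x; rewrite abx; apply/forallP => y; apply/implyP => yb.
have [->|yE] := atom_below atom_b (ltW yb); first by rewrite join0x.
by rewrite yE ltxx in yb.
Qed.

(** This is the minimality condition of D at y = 0. *)
Lemma join_dep_cover a b :
  join_dep a b -> exists2 x, a <= b `|` x & ~~ (a <= x).
Proof.
case/and4P=> _ /andP[b_neq0 _] _ /existsP[x /andP[abx /forallP min_b]].
exists x => //; move/(_ \bot)/implyP: min_b.
by rewrite lt0x join0x => ->.
Qed.

(** If b <= c \/ x, then b <= c or b <= x. In the first case b < c, so y = b
    violates the minimality of c; in the second case y = 0 does. *)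
Lemma join_prime_not_dep b c : join_prime b -> ~ join_dep b c.
Proof.
move=> prime_b bDc; have [x bcx bx] := join_dep_cover bDc.
case/and4P: bDc => _ _ bc /existsP[y /andP[bcy /forallP min_c]].
have [b_le_c|b_le_y] := prime_b _ _ bcy.
  by have := min_c b; rewrite lt_neqAle bc b_le_c leUl.
case: (prime_b _ _ bcx) => [b_le_c|]; last exact/negP.
by have := min_c b; rewrite lt_neqAle bc b_le_c leUl.
Qed.

Lemma no_D_cycle :
  (forall a b : L, join_dep a b -> join_prime b) ->
  forall s : seq L, ~ D_cycle s.
Proof.
move=> dep_prime [|a [|b s]] [//= _]; first by rewrite /join_dep eqxx !andbF.
case/andP=> aDb; case: s => [|c s] /andP[bDc _];
  exact: join_prime_not_dep (dep_prime _ _ aDb) bDc.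
Qed.

End JoinDependency.

(** * Points of an embedding into the order-convex subsets *)
Section Embedding.
Context {d d' : Order.disp_t} {L : finTBLatticeType d} {P : porderType d'}.
Variable f : {lmorphism L -> Co P}.
Hypothesis f_inj : injective f.
Hypothesis atomistic_L : atomistic L.
Implicit Types (a b x y : L) (p q : P).

Local Notation F x := (co_set (f x)).

Lemma image_mono x y p : x <= y -> F x p -> F y p.
Proof. by move=> xy; apply: co_subset; apply: omorph_le. Qed.

Lemma image_convex x p q r : F x p -> F x r -> p <= q <= r -> F x q.
Proof. by move=> xp xr /andP[pq qr]; apply: co_convexP xp xr pq qr. Qed.

Lemma in_imageU x y p :
  F (x `|` y) p <->
  exists l h, [/\ F x l \/ F y l, F x h \/ F y h & l <= p <= h].
Proof. by rewrite omorphU in_co_join. Qed.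

Definition marks a p : Prop := [/\ atom a, F a p & ~ F \bot p].

(** The meet of a and x is 0 or a, and p, being in its image, excludes 0. *)
Lemma marks_le a x p : marks a p -> F x p -> a <= x.
Proof.
move=> [atom_a ap p0] xp; have : F (a `&` x) p by rewrite omorphI.
case: (atom_below atom_a (leIl a x)) => [->//|<- _]; exact: leIr.
Qed.

Lemma atom_marks a : atom a -> exists p, marks a p.
Proof.
move=> atom_a; apply: contrapT => no_p.
suff fa0 : f a = f \bot by have := atom_gt0 atom_a; rewrite (f_inj fa0) ltxx.
apply/le_anti/andP; split; last exact/omorph_le/le0x.
rewrite co_leE; apply/asboolP => p ap; apply: contrapT => p0.
by apply: no_p; exists p.
Qed.

(** The Boolean picks the order of P or its dual, so that mirror-image arguments
    are made once. *)
Definition side (up : bool) p q : bool := if up then p <= q else q <= p.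

Lemma side_refl up p : side up p p.
Proof. by case: up => /=. Qed.

Definition reaches up x p : Prop :=
  exists b q, [/\ atom b, b <= x, F b q & side up p q].

Lemma reaches_mono up x y p q :
  x <= y -> side up p q -> reaches up x q -> reaches up y p.
Proof.
move=> xy pq [b [r [atom_b bx br qr]]].
exists b, r; split=> //; first exact: le_trans bx xy.
by case: up pq qr => /= [pq|qp]; [apply: le_trans | move/le_trans; apply].
Qed.

(** A point of f(x) off f(0) has points of images of atoms below x on both of
    its sides: x is a join of atoms, and a point of f(y \/ z) in neither f(y)
    nor f(z) is enclosed by points of f(y) and f(z). These are off f(0) too,
    since otherwise convexity would bring p into f(y) or f(z). *)
Lemma reaches_all up x p : F x p -> ~ F \bot p -> reaches up x p.
Proof.
have [A atomA xE] := atomistic_L x; rewrite xE.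
elim/big_ind: _ p => [//|y z IHy IHz|b Ab] p; last first.
  by move=> bp _; exists b, p; split=> //; [apply: atomA | apply: side_refl].
move=> yzp p0; have [l [h [yzl yzh lph]]] := (in_imageU _ _ _).1 yzp.
have [yp|yp] := EM (F y p).
  by apply: (reaches_mono (leUl y z) (side_refl up p)); apply: IHy.
have [zp|zp] := EM (F z p).
  by apply: (reaches_mono (leUr _ _) (side_refl up p)); apply: IHz.
have l0 : ~ F \bot l.
  move=> bot_l; case: yzh => [yh|zh]; [apply: yp | apply: zp];
  by apply: (image_convex _ _ lph) => //; apply: image_mono (le0x _) bot_l.
have h0 : ~ F \bot h.
  move=> bot_h; case: yzl => [yl|zl]; [apply: yp | apply: zp];
  by apply: (image_convex _ _ lph) => //; apply: image_mono (le0x _) bot_h.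
case/andP: lph => lp ph.
have reach q : F y q \/ F z q -> ~ F \bot q -> side up p q ->
    reaches up (y `|` z) p.
  case=> [yq|zq] q0 pq.
    exact: reaches_mono (leUl _ _) pq (IHy _ yq q0).
  exact: reaches_mono (leUr _ _) pq (IHz _ zq q0).
by case: (up) reach => reach; [apply: (reach h) | apply: (reach l)].
Qed.

Lemma in_imageU_side x y p : F (x `|` y) p -> ~ F x p -> ~ F y p ->
  exists up l h, [/\ F x l, F y h, side up p h & side (~~ up) p l].
Proof.
case/in_imageU=> l [h [[xl|yl] [xh|yh] lph]] xp yp.
- by case: xp; apply: image_convex lph.
- by exists true, l, h; case/andP: lph.
- by exists false, h, l; case/andP: lph.
- by case: yp; apply: image_convex lph.
Qed.

Lemma side_imageU up x y p q r :
  F x q -> F y r -> side up p q -> side (~~ up) p r -> F (x `|` y) p.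
Proof.
move=> xq yr pq pr; apply/in_imageU; case: up pq pr => /= pq pr.
  by exists r, q; split; rewrite ?pq ?pr; [right|left|].
by exists q, r; split; rewrite ?pq ?pr; [left|right|].
Qed.

(** * Targets of join-dependency are join-prime *)
Section NoTwoCycle.
Hypothesis no_2cycle : forall a b : L, ~ D_cycle [:: a; b].

(** A failure of join-primeness of b would give b D a by looking at the point
    of f(b) that, together with a point of f(w), encloses a point marked by
    a. *)
Lemma join_dep_prime a b : join_dep a b -> join_prime b.
Proof.
move=> aDb; have [w abw aw] := join_dep_cover aDb.
case/and4P: (aDb) => ji_a ji_b ab _.
have [atom_a atom_b] := (ji_atom atomistic_L ji_a, ji_atom atomistic_L ji_b).
have [p [_ ap p0]] := atom_marks atom_a; have ma : marks a p by [].
have wp : ~ F w p by move=> wp; case/negP: aw; apply: marks_le wp.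
have bp : ~ F b p.
  move/(marks_le ma)/(atom_below atom_b) => [a0|aE].
    by have := atom_gt0 atom_a; rewrite a0 ltxx.
  by rewrite aE eqxx in ab.
have [up [q [r [bq wr pr pq]]]] := in_imageU_side (image_mono abw ap) bp wp.
have mb : marks b q.
  split=> // q0; apply: wp.
  have: F (w `|` w) p by apply: side_imageU wr _ pr pq; apply: image_mono q0.
  by rewrite joinxx.
have qp : side up q p by case: (up) pq.
(* A point of f(t) beyond q, as seen from p, gives b <= a \/ t, hence b D a. *)
have half t s : F t s -> ~~ (b <= t) -> ~ side (~~ up) q s.
  move=> ts bt qs; apply: (no_2cycle (a := a) (b := b)); split=> //=.
  rewrite aDb andbT; apply: (atom_join_dep (x := t)) => //.
    by rewrite eq_sym.
  exact: marks_le mb (side_imageU ap ts qp qs).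
move=> u v buv; have [bu|bu] := boolP (b <= u); first by left.
have [bv|bv] := boolP (b <= v); first by right.
have uq : ~ F u q by move/(marks_le mb); apply/negP.
have vq : ~ F v q by move/(marks_le mb); apply/negP.
have [up' [l [h [ul vh qh ql]]]] := in_imageU_side (image_mono buv bq) uq vq.
have [ud|ud] := eqVneq up up'.
  by case: (half _ _ ul bu); rewrite ud.
by case: (half _ _ vh bv); case: (up) (up') ud qh => [] [].
Qed.

(** * The embedding into the order-convex subsets of a fan *)

Definition fan_image x : fan P L -> Prop := fun t =>
  (exists a, marks a t.1) /\
  match t.2 with
  | None => F x t.1
  | Some (up, b) =>
      [/\ b <= x, join_prime b & exists2 q, F b q & side up t.1 q]
  end.

(** Only a middle element p lies strictly between two others; if copies of b
    below p and of c above p are in the image, then p is between points of f(b)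
    and f(c), both contained in f(x). *)
Lemma fan_image_convex x : order_convex (fan_image x).
Proof.
move=> s t r xs xt; rewrite [s <= r]le_eqVlt [r <= t]le_eqVlt.
case/predU1P=> [<-//|sr] /predU1P[->//|rt].
case/andP: sr rt => /eqP + hsr /andP[/eqP + hrt].
move: xs xt hsr hrt; rewrite /fan_image.
case: s r t => [p1 s] [p r] [p2 t] /= [ma xs] [_ xt] hsr hrt e1 e2; subst.
split=> //; move: s r t hsr hrt xs xt.
move=> [[[] b]|] [[[] c]|] [[[] e]|] //= _ _.
move=> [bx _ [q bq qp]] [ex _ [q' eq' pq']].
by apply: image_convex (image_mono bx bq) (image_mono ex eq') _; rewrite qp.
Qed.

Definition fan_co x : Co (fan P L) := MkCo (asboolT (@fan_image_convex x)).

Lemma fan_co_mono : {homo fan_co : x y / x <= y}.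
Proof.
move=> x y xy; rewrite co_leE; apply/asboolP => -[p [[up b]|]] [ma /= xp].
  by case: xp => bx prime_b bq; split=> //; split=> //; apply: le_trans bx xy.
by split=> //; apply: image_mono xp.
Qed.

Lemma fan_coI : {morph fan_co : x y / x `&` y}.
Proof.
move=> x y; apply/le_anti/andP; split.
  by rewrite lexI !fan_co_mono ?leIl ?leIr.
rewrite co_leE; apply/asboolP => -[p [[up b]|]] [[ma xp] [_ yp]]; split=> //=.
  by case: xp yp => bx prime_b bq [bry _ _]; rewrite lexI bx.
by rewrite omorphI.
Qed.

(** The only nontrivial inclusion concerns a middle point p of f(x \/ y), which
    has to be enclosed by copies of join-prime elements below x and below y. *)
Lemma fan_coU : {morph fan_co : x y / x `|` y}.
Proof.
move=> x y; apply/le_anti/andP; split; last first.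
  by rewrite leUx !fan_co_mono ?leUl ?leUr.
have in_l t : co_set (fan_co x) t -> co_set (fan_co x `|` fan_co y) t.
  by apply: co_subset; apply: leUl.
have in_r t : co_set (fan_co y) t -> co_set (fan_co x `|` fan_co y) t.
  by apply: co_subset; apply: leUr.
rewrite co_leE; apply/asboolP => -[p [[up b]|]] [[a ma] /= xyp].
  case: xyp => bxy prime_b bq.
  by have [bx|bry] := prime_b _ _ bxy; [apply: in_l | apply: in_r];
    split=> //; exists a.
have [xp|xp] := EM (F x p); first by apply: in_l; split=> //; exists a.
have [yp|yp] := EM (F y p); first by apply: in_r; split=> //; exists a.
have [up [l [h [xl yh ph pl]]]] := in_imageU_side xyp xp yp.
(* As p is off f(z) and f(z'), the atom a marking p satisfies a D b for any
   atom b <= z reached from p on the side of q, so b is join-prime. *)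
have arm z z' up' q q' : ~ F z p -> ~ F z' p -> F z q -> F z' q' ->
    side up' p q -> side (~~ up') p q' ->
    exists b, co_set (fan_co z) (p, Some (up', b)).
  move=> zp z'p zq z'q' pq pq'; have q0 : ~ F \bot q.
    move=> q0; apply: z'p; have z'q := image_mono (le0x z') q0.
    by rewrite -(joinxx z'); apply: side_imageU z'q z'q' pq pq'.
  have [b [r [atom_b bz br pr]]] :=
    reaches_mono (lexx z) pq (reaches_all up' zq q0).
  exists b; split; first by exists a.
  split=> //; last by exists r.
  have [atom_a _ _] := ma; apply: (@join_dep_prime a).
  apply: (atom_join_dep (x := z')) => //.
  - apply: contra_notN zp => /eqP ab; apply: image_mono bz _; rewrite -ab.
    by case: ma.
  - exact: marks_le ma (side_imageU br z'q' pr pq').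
  - by apply/negP => az'; apply: z'p; apply: image_mono az' _; case: ma.
have [b xb] : exists b, co_set (fan_co x) (p, Some (~~ up, b)).
  by apply: (arm x y _ l h) => //; rewrite negbK.
have [c yc] : exists c, co_set (fan_co y) (p, Some (up, c)).
  exact: (arm y x _ h l).
have xyb := in_l _ xb; have xyc := in_r _ yc.
have sandwich e e' : co_set (fan_co x `|` fan_co y) (p, Some (false, e)) ->
    co_set (fan_co x `|` fan_co y) (p, Some (true, e')) ->
    co_set (fan_co x `|` fan_co y) (p, None).
  by move=> lo hi; apply: (co_convexP lo hi); rewrite fan_leE /fan_lt eqxx orbT.
by case: up xyb xyc {xb yc ph pl} => xyb xyc;
  [apply: sandwich xyb xyc | apply: sandwich xyc xyb].
Qed.

Lemma fan_co_inj : injective fan_co.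
Proof.
suff le_fan x y : fan_co x <= fan_co y -> x <= y.
  move=> x y xy; apply/le_anti.
  by rewrite !le_fan // xy.
rewrite co_leE => /asboolP xy; apply: atomistic_le => // a atom_a ax.
have [p ma] := atom_marks atom_a; have [_ ap _] := ma.
have [|_ yp] := xy (p, None); last exact: marks_le ma yp.
by split=> /=; [exists a | apply: image_mono ap].
Qed.

HB.instance Definition _ :=
  Order.isOrderMorphism.Build _ _ _ _ fan_co fan_co_mono.
HB.instance Definition _ :=
  Order.isLatticeMorphism.Build _ _ _ _ fan_co fan_coI fan_coU.

Lemma embeds_fan : embeds L (Co (fan P L)).
Proof. by exists fan_co; apply: fan_co_inj. Qed.

End NoTwoCycle.

End Embedding.

Theorem proposition3p9 (d : Order.disp_t) (L : finTBLatticeType d)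
    (atomistic_L : atomistic L)
    (no_2cycle : forall a b : L, ~ D_cycle [:: a; b]) :
  (SUB L <-> SUB2 L) /\
  (SUB L -> forall s : seq L, ~ D_cycle s).
Proof.
split; first split.
- case=> d' [P [f f_inj]]; exists fan_display, (fan P L).
  split; first exact: length_fan.
  exact: embeds_fan f_inj atomistic_L no_2cycle.
- by case=> d' [P [_ L_P]]; exists d', P.
- case=> d' [P [f f_inj]]; apply: no_D_cycle => a b.
  exact: (join_dep_prime f_inj atomistic_L no_2cycle).
Qed.
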